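(* Let $q$ be an odd prime power and let $a,b,c\in\mathbb F_{q^2}$. If $a^q+b\notin\mathbb F_q$, then the number of zeros of $x^{q+1}+x^2+ax^q+bx+c$ in $\mathbb F_{q^2}$ is equal to the number of zeros in $\mathbb F_q$ of \[x^3-\operatorname{Tr}(3a-b)x^2+(4\operatorname{Tr}(\gamma)-\epsilon^2)x+4\operatorname{Tr}(\gamma\epsilon)+\operatorname{Tr}(3a-b)\epsilon^2,\] where $\gamma=a^2-ab+c$ and $\epsilon=a^q-a-b^q+b$. If $a^q+b\in\mathbb F_q$, then the number of zeros of $x^{q+1}+x^2+ax^q+bx+c$ in $\mathbb F_{q^2}$ is \[\eta\big((a^q+b)^2-4\operatorname{Tr}(c)\big)+M_0,\] where \[M_0=\begin{cases}1&\text{if }\operatorname{Tr}(a^2-ab+c)\neq0,\\ q&\text{if }a^2-ab+c=0,\\ 0&\text{otherwise.}\end{cases}\]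
   Context: $\operatorname{Tr}(x)=x^q+x$ for $x\in\mathbb F_{q^2}$. $\eta$ is the quadratic character of $\mathbb F_q^*$ (value $1$ on nonzero squares, $-1$ on nonsquares), with the convention $\eta(0)=0$. The number of zeros means the number of distinct elements at which the polynomial vanishes. *)

(* Defs.v *)
From HB Require Import structures.
From mathcomp Require Import all_boot all_order all_algebra.

Set Implicit Arguments.
Unset Strict Implicit.
Unset Printing Implicit Defensive.

Import GRing.Theory.
Local Open Scope ring_scope.

(* Here F is the field with q ^ 2 elements and K its subfield with q elements,
   given as a subset of F, so that elements of K need no coercion into F. *)
Definition is_subfield_of_order (F : finFieldType) (K : {set F}) (q : nat) :=
  GRing.divring_closed K /\ #|K| = q.

Definition Tr (F : finFieldType) (q : nat) (x : F) : F := x ^+ q + x.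

(* Only meaningful for x in K; being a square refers to squares of elements
   of K (every element of K is a square in F). *)
Definition quad_char (F : finFieldType) (K : {set F}) (x : F) : int :=
  if x == 0 then 0 else if [exists y in K, y ^+ 2 == x] then 1 else -1.

Definition num_zeros (F : finFieldType) (A : {set F}) (P : {poly F}) : nat :=
  #|[set x in A | root P x]|.

(* Main.v *)
Require Import Defs.
From HB Require Import structures.
From mathcomp Require Import all_boot all_order all_algebra all_field.
From mathcomp Require Import ring.

Set Implicit Arguments.
Unset Strict Implicit.
Unset Printing Implicit Defensive.

Import GRing.Theory.
Local Open Scope ring_scope.

(** Write x' for x ^ q, t = Tr x, d = b - a and gamma = a^2 - a b + c. Since
    x' = t - x, the polynomial takes at x the value (x + a)(t + d) + gamma,
    which is affine in x once t is known. A zero with t + d != 0 is therefore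
    determined by its trace, x = - a - gamma / (t + d), and conversely this
    formula gives a zero exactly when its own trace is t, i.e. when
    t + Tr a + Tr (gamma / (t + d)) = 0 (card_zeros_trace). So the zeros with
    t + d != 0 are counted by an equation for t in the subfield K.

    The element epsilon equals d - d', so a' + b lies in K iff d does, iff
    epsilon = 0.
    - If d is not in K, then t + d never vanishes; multiplying the equation by
      the norm of t + d turns it into a cubic in t, and the substitution
      s = - (2 t + Tr d) turns that cubic into the stated one.
    - If d is in K, multiplying by t + d gives the quadratic
      (t + Tr a)(t + d) + Tr gamma = 0, of discriminant (a' + b)^2 - 4 Tr c,
      so with 1 + eta((a' + b)^2 - 4 Tr c) roots in K. The root
      t = - d has to be discarded, and it occurs only when Tr gamma = 0. The
      zeros of f with t = - d exist only if gamma = 0, and then they form a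
      whole fibre of the trace, which has q elements. *)

Lemma card_in_can (T T' : finType) (A : {set T}) (B : {set T'})
    (f : T -> T') (g : T' -> T) :
  {in A, forall x, f x \in B} -> {in B, forall y, g y \in A} ->
  {in A, cancel f g} -> {in B, cancel g f} -> #|A| = #|B|.
Proof.
move=> fAB gBA fK gK; rewrite -(card_in_imset (can_in_inj fK)).
congr #|pred_of_set _|; apply/setP=> y; apply/imsetP/idP => [[x Ax ->]|By].
  exact: fAB.
by exists (g y); rewrite ?gK ?gBA.
Qed.

Section QuadraticExtension.

Variables (p k q : nat) (F : finFieldType) (K : {set F}).
Hypotheses (p_prime : prime p) (q_def : q = (p ^ k)%N) (q_odd : odd q).
Hypotheses (cardF : #|F| = (q ^ 2)%N) (subK : is_subfield_of_order K q).

(** * Conjugation and the subfield *)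

(** A name for the q-th power, opaque to the ring tactic, which would otherwise
    try to normalize a power with a variable exponent. *)
Definition conjq (x : F) : F := x ^+ q.

Lemma pcharFp : p \in [pchar F].
Proof. by apply: (card_finPcharP (n := (k * 2)%N)); rewrite // expnM -q_def. Qed.

Lemma conjqD x y : conjq (x + y) = conjq x + conjq y.
Proof.
rewrite /conjq exprDn_pchar // q_def.
by rewrite (eq_pnat _ (pcharf_eq pcharFp)) pnatX pnat_id.
Qed.

Lemma q_gt1 : (1 < q)%N.
Proof.
have : (1 < #|F|)%N by exact: finNzRing_gt1.
by rewrite cardF; case: (q) => [|[]].
Qed.

Lemma conjqM x y : conjq (x * y) = conjq x * conjq y.
Proof. exact: exprMn. Qed.

Lemma conjqV x : conjq x^-1 = (conjq x)^-1.
Proof. exact: exprVn. Qed.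

Lemma conjqN x : conjq (- x) = - conjq x.
Proof. by rewrite /conjq exprNn -signr_odd q_odd mulN1r. Qed.

Lemma conjqB x y : conjq (x - y) = conjq x - conjq y.
Proof. by rewrite conjqD conjqN. Qed.

Lemma conjq1 : conjq 1 = 1.
Proof. exact: expr1n. Qed.

Lemma conjq_nat n : conjq n%:R = n%:R.
Proof.
elim: n => [|n IHn]; first by rewrite /conjq expr0n -leqn0 leqNgt (ltnW q_gt1).
by rewrite -natr1 conjqD IHn conjq1.
Qed.

Lemma conjqK : involutive conjq.
Proof. by move=> x; rewrite /conjq -exprM mulnn -cardF expf_card. Qed.

Lemma nat2_neq0 : 2%:R != 0 :> F.
Proof.
rewrite -(dvdn_pcharf pcharFp) dvdn_prime2 //; apply/negP => /eqP p2.
have := q_odd; have := q_gt1; rewrite q_def p2.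
by case: (k) => // m _; rewrite oddX.
Qed.

Lemma pow2_neq0 n : (2 ^ n)%N%:R != 0 :> F.
Proof. by rewrite natrX expf_neq0 // nat2_neq0. Qed.

Lemma TrE x : Tr q x = conjq x + x.
Proof. by []. Qed.

Lemma TrN (x : F) : Tr q (- x) = - Tr q x.
Proof. by rewrite !TrE conjqN opprD. Qed.

Lemma TrD (x y : F) : Tr q (x + y) = Tr q x + Tr q y.
Proof. by rewrite !TrE conjqD addrACA. Qed.

(** Every element of K is fixed, because multiplication by a nonzero x permutes
    the nonzero elements of K; there are no other fixed points, because
    X^q - X has at most q roots. *)
Lemma memK x : (x \in K) = (conjq x == x).
Proof.
have [[K1 KB KV] cardK] := subK.
have K0 : 0 \in K by rewrite -(subrr 1) KB.
have KM u v : u \in K -> v \in K -> u * v \in K.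
  by move=> Ku Kv; rewrite -[v]invrK KV // -[_^-1]mul1r KV.
have fixK u : u \in K -> conjq u = u.
  have [->|u0 Ku] := eqVneq u 0; first by rewrite -[0]/(0%:R) conjq_nat.
  pose P := \prod_(y in K :\ 0) y.
  have P0 : P != 0.
    by apply/prodf_neq0 => y; rewrite !inE; case/andP.
  have : P = u ^+ q.-1 * P.
    have -> : q.-1 = #|K :\ 0| by rewrite -cardK (cardsD1 0 K) K0.
    rewrite -prodr_const -big_split /= {1}/P.
    rewrite (reindex_onto ( *%R u) ( *%R u^-1)) /=; last first.
      by move=> y _; rewrite mulVKf.
    apply: eq_bigl => y; rewrite mulKf // eqxx andbT !inE mulf_eq0 negb_or u0 /=.
    case: eqP => //= _; apply/idP/idP => [Kuy|]; last exact: KM.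
    by rewrite -[y](mulKf u0) KM // -[u^-1]mul1r KV.
  move/eqP; rewrite -{1}[P]mul1r => /eqP/(mulIf P0) uq.
  by rewrite /conjq -(prednK (ltnW q_gt1)) exprS -uq mulr1.
pose g : {poly F} := 'X^q - 'X.
have sg : size g = q.+1.
  by rewrite size_polyDl ?size_polyXn // size_polyN size_polyX ltnS q_gt1.
have g0 : g != 0 by rewrite -size_poly_eq0 sg.
have rootg u : root g u = (conjq u == u).
  by rewrite /root /g !hornerE subr_eq0.
apply/idP/idP => [Kx|xx]; first by rewrite fixK.
apply/negPn/negP => Kx.
have : (size (x :: enum K) < size g)%N.
  apply: max_poly_roots => //=.
    rewrite rootg xx; apply/allP => u; rewrite mem_enum rootg => /fixK ->.
    exact: eqxx.
  by rewrite mem_enum Kx enum_uniq.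
by rewrite sg /= -cardE cardK ltnn.
Qed.

Lemma KP x : reflect (conjq x = x) (x \in K).
Proof. by rewrite memK; exact: eqP. Qed.

Lemma memK_Tr x : Tr q x \in K.
Proof. by apply/KP; rewrite TrE conjqD conjqK addrC. Qed.

(** Conjugation changes the sign of x - x' for any x, so the fibre over e is a
    translate by e / 2 of the line K * (x - x') for an x outside K. *)
Lemma card_Tr_fiber e : e \in K -> #|[set x : F | Tr q x == e]| = q.
Proof.
move=> /KP Ke.
have [u Ku] : exists u, u \notin K.
  apply/existsP; rewrite -negb_forall; apply/negP => /forallP allK.
  have : (#|F| <= #|K|)%N by rewrite subset_leq_card //; apply/subsetP.
  rewrite cardF subK.2 -{2}[q]expn1 leq_exp2l ?q_gt1 //.
(* z spans the elements of trace 0 over K. *)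
pose z := u - conjq u.
have z0 : z != 0 by rewrite subr_eq0 eq_sym -memK.
have zN : conjq z = - z by rewrite conjqB conjqK opprB.
have n2 := nat2_neq0.
rewrite -[RHS]subK.2; apply: (card_in_can (f := fun x => (x - e / 2%:R) / z)
  (g := fun y => e / 2%:R + y * z)) => [x|y|x _|y _].
- rewrite inE TrE => /eqP xe; apply/KP.
  rewrite conjqM conjqB conjqM !conjqV zN conjq_nat Ke.
  have -> : conjq x = e - x by rewrite -xe addrK.
  by field; rewrite oppr_eq0 z0 n2.
- move=> /KP Ky; rewrite inE TrE conjqD !conjqM conjqV conjq_nat zN Ke Ky.
  by apply/eqP; field.
- by rewrite divfK // addrC subrK.
- by rewrite addrC addKr mulfK.
Qed.

Lemma card_sqrt D : D \in K ->
  (#|[set y in K | y ^+ 2 == D]|)%:Z = 1 + quad_char K D.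
Proof.
move=> KD; rewrite /quad_char; case: eqVneq => [->|D0].
  rewrite (_ : [set _ in _ | _] = [set 0]) ?cards1 //.
  apply/setP => y; rewrite !inE expf_eq0 /=.
  by case: eqVneq => [->|]; rewrite ?andbF // memK -[0]/(0%:R) conjq_nat eqxx.
case: existsP => [[y /andP [Ky /eqP yD]]|noy]; last first.
  rewrite (_ : [set _ in _ | _] = set0) ?cards0 //; apply/setP => y.
  by rewrite !inE; apply/negP => Hy; apply: noy; exists y.
have y0 : y != 0 by apply: contraNneq D0 => y0; rewrite -yD y0 expr0n.
rewrite (_ : [set _ in _ | _] = [set y; - y]) ?cards2.
  suff -> : y != - y by [].
  by rewrite -addr_eq0 -mulr2n -mulr_natl mulf_neq0 ?nat2_neq0.
apply/setP => v; rewrite !inE -yD eqf_sqr.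
case: eqP => [->|_]; first by rewrite Ky.
by case: eqP => [->|_]; rewrite ?andbF // memK conjqN (KP _ Ky) eqxx.
Qed.

(** Completing the square, y = 2 t + s. *)
Lemma card_quadratic s r : s \in K -> r \in K ->
  (#|[set t in K | t ^+ 2 + s * t + r == 0]|)%:Z
    = 1 + quad_char K (s ^+ 2 - 4%:R * r).
Proof.
move=> /KP Ks /KP Kr; have n2 := nat2_neq0.
rewrite -card_sqrt; last first.
  by apply/KP; rewrite conjqB expr2 !conjqM conjq_nat Ks Kr.
congr Posz; apply: (card_in_can (f := fun t => 2%:R * t + s)
  (g := fun y => (y - s) / 2%:R)) => [t|y|t _|y _].
- rewrite !inE => /andP [/KP Kt /eqP t0]; apply/andP; split.
    by apply/KP; rewrite conjqD conjqM conjq_nat Ks Kt.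
  apply/eqP.
  have -> : (2%:R * t + s) ^+ 2
     = 4%:R * (t ^+ 2 + s * t + r) + (s ^+ 2 - 4%:R * r) by ring.
  by rewrite t0 mulr0 add0r.
- rewrite !inE => /andP [/KP Ky /eqP yD]; apply/andP; split.
    by apply/KP; rewrite conjqM conjqV conjqB conjq_nat Ks Ky.
  apply/eqP.
  have -> : ((y - s) / 2%:R) ^+ 2 + s * ((y - s) / 2%:R) + r
     = (y ^+ 2 - (s ^+ 2 - 4%:R * r)) / 2%:R ^+ 2.
    by field; rewrite (pow2_neq0 2) n2.
  by rewrite yD subrr mul0r.
- by rewrite addrK mulrC mulKf.
- by rewrite mulrC divfK // subrK.
Qed.

(** * The zeros of f as a function of their trace *)

Variables (a b c : F).
Let f : {poly F} := 'X^(q.+1) + 'X^2 + a *: 'X^q + b *: 'X + c%:P.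
Let gamma := a ^+ 2 - a * b + c.
Let d := b - a.

(** The gain over the definition of f is that, once the trace is fixed, the
    equation is affine in x. *)
Lemma root_trace x : root f x = ((x + a) * (Tr q x + d) + gamma == 0).
Proof.
rewrite /root; have -> : f.[x] = x * conjq x + x ^+ 2 + a * conjq x + b * x + c.
  by rewrite /f !hornerE exprS.
congr (_ == _); rewrite TrE /gamma /d; ring.
Qed.

(** For t + d != 0 the equation (x + a)(t + d) + gamma = 0 is solved for x; the
    solution is a zero of f precisely when its trace is the t one started
    from. *)
Lemma card_zeros_trace :
  #|[set x | root f x & Tr q x + d != 0]| =
  #|[set t in K | (t + d != 0) &&
       (t + Tr q a + Tr q (gamma / (t + d)) == 0)]|.
Proof.
have solve x : root f x -> Tr q x + d != 0 -> x = - a - gamma / (Tr q x + d).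
  rewrite root_trace => /eqP x0 h.
  have -> : gamma = - ((x + a) * (Tr q x + d)).
    by apply/eqP; rewrite -addr_eq0 addrC x0.
  by rewrite mulNr mulfK // opprK addrC addrK.
apply: (card_in_can (f := Tr q) (g := fun t => - a - gamma / (t + d)))
    => [x|t|x|t].
- rewrite !inE memK_Tr => /andP [fx h]; rewrite h /=.
  by rewrite {1}(solve x fx h) TrD !TrN -opprD -addrA addNr.
- rewrite !inE => /andP [_ /andP [h /eqP t0]].
  have Trt : Tr q (- a - gamma / (t + d)) = t.
    by rewrite TrD !TrN -opprD; apply/eqP; rewrite eq_sym -addr_eq0 addrA t0.
  by rewrite Trt h root_trace Trt andbT; apply/eqP; field.
- by rewrite inE => /andP [fx h]; rewrite -solve.
- rewrite !inE => /andP [_ /andP [h /eqP t0]].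
  by rewrite TrD !TrN -opprD; apply/eqP; rewrite eq_sym -addr_eq0 addrA t0.
Qed.

(** As d is not in K, the equation for t can be multiplied by the norm of t + d
    without gaining roots. With s = - (2 t + Tr d) one has t + d = (e - s) / 2
    and t + d' = - (e + s) / 2, so that the norm becomes (s^2 - e^2) / 4. *)
Lemma card_zeros_cubic (e := conjq a - a - conjq b + b) : a ^+ q + b \notin K ->
  #|[set x | root f x]| =
  #|[set s in K | s ^+ 3 - Tr q (3%:R * a - b) * s ^+ 2
        + (4%:R * Tr q gamma - e ^+ 2) * s
        + (4%:R * Tr q (gamma * e) + Tr q (3%:R * a - b) * e ^+ 2) == 0]|.
Proof.
move=> Kab; have n2 := nat2_neq0.
have td0 t : t \in K -> t + d != 0.
  move=> /KP Kt; apply: contra Kab; rewrite addr_eq0 => /eqP td; apply/KP.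
  move: Kt; rewrite td conjqN => /oppr_inj; rewrite /d conjqB => dK.
  rewrite -/(conjq a) conjqD conjqK; apply/eqP; rewrite -subr_eq0.
  have -> : a + conjq b - (conjq a + b) = (conjq b - conjq a) - (b - a) by ring.
  by rewrite dK subrr.
have -> : [set x | root f x] = [set x | root f x & Tr q x + d != 0].
  by apply/setP => x; rewrite !inE td0 ?andbT // memK_Tr.
rewrite card_zeros_trace.
have KTrd : conjq (Tr q d) = Tr q d by apply/KP; exact: memK_Tr.
have half s : - (2%:R * ((- s - Tr q d) / 2%:R) + Tr q d) = s by field.
have half' t : (- - (2%:R * t + Tr q d) - Tr q d) / 2%:R = t by field.
have cubicE t : t \in K ->
    let s := - (2%:R * t + Tr q d) in
    s ^+ 3 - Tr q (3%:R * a - b) * s ^+ 2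
      + (4%:R * Tr q gamma - e ^+ 2) * s
      + (4%:R * Tr q (gamma * e) + Tr q (3%:R * a - b) * e ^+ 2)
    = - (8%:R * ((t + d) * conjq (t + d)))
        * (t + Tr q a + Tr q (gamma / (t + d))).
  move=> Kt s; have h := td0 t Kt.
  have h' : conjq (t + d) != 0 by rewrite expf_neq0.
  move: h'; rewrite /s !TrE /e.
  have -> : conjq (gamma / (t + d)) = conjq gamma / conjq (t + d).
    by rewrite conjqM conjqV.
  rewrite !(conjqM, conjqD, conjqN, conjq_nat, conjqK) (KP _ Kt).
  rewrite -/d.
  move: (conjq gamma) (conjq a) (conjq b) h => g' a' b' h h'.
  rewrite /d in h *; field.
  by rewrite h' h.
have neq0 t : t \in K -> - (8%:R * ((t + d) * conjq (t + d))) != 0.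
  move=> Kt; rewrite oppr_eq0 !mulf_neq0 ?expf_neq0 ?td0 //.
  exact: (pow2_neq0 3).
apply: (card_in_can (f := fun t => - (2%:R * t + Tr q d))
  (g := fun s => (- s - Tr q d) / 2%:R)) => [t|s|t _|s _] //.
- rewrite !inE => /andP [Kt /andP [_ t0]]; rewrite cubicE // mulf_eq0 t0 orbT.
  by rewrite andbT memK conjqN conjqD conjqM conjq_nat KTrd (KP _ Kt).
- rewrite !inE => /andP [/KP Ks]; rewrite -{1 2 3}[s]half.
  have Kt : (- s - Tr q d) / 2%:R \in K.
    by apply/KP; rewrite conjqM conjqV conjqB conjqN conjq_nat KTrd Ks.
  by rewrite cubicE // mulf_eq0 (negPf (neq0 _ Kt)) Kt td0.
Qed.

(** The quadratic comes from clearing the denominator t + d, which now lies in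
    K. Its value at t = - d is Tr gamma, so that root is present, and its removal
    cancels the 1 in the root count 1 + eta, exactly when Tr gamma = 0. *)
Lemma card_zeros_quadratic : a ^+ q + b \in K ->
  (#|[set x | root f x]|)%:Z =
  quad_char K ((a ^+ q + b) ^+ 2 - 4%:R * Tr q c)
  + (if Tr q gamma != 0 then 1 else if gamma == 0 then q%:Z else 0).
Proof.
move=> /KP; rewrite -/(conjq a) conjqD conjqK => Kab; have n2 := nat2_neq0.
have Kd : conjq d = d.
  rewrite conjqB; have -> : conjq b = conjq a + b - a by rewrite -Kab addrC addKr.
  by rewrite /d; ring.
have KTr x : conjq (Tr q x) = Tr q x by apply/KP; exact: memK_Tr.
have Trc : Tr q c = Tr q gamma + d * Tr q a.
  rewrite !TrE.
  have {1}-> : c = gamma + a * d by rewrite /gamma /d; ring.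
  by rewrite conjqD conjqM Kd /gamma /d; ring.
have -> : (conjq a + b) ^+ 2 - 4%:R * Tr q c
    = (Tr q a + d) ^+ 2 - 4%:R * (d * Tr q a + Tr q gamma).
  by rewrite Trc (TrE a) /d; ring.
(* The zeros with t + d = 0 fill a whole fibre of the trace or do not exist. *)
rewrite -(cardsID [set x | Tr q x + d != 0]) PoszD.
have -> : [set x | root f x] :&: [set x | Tr q x + d != 0]
    = [set x | root f x & Tr q x + d != 0].
  by apply/setP => x; rewrite !inE.
have -> : #|[set x | root f x] :\: [set x | Tr q x + d != 0]|
    = if gamma == 0 then q else 0%N.
  have -> : [set x | root f x] :\: [set x | Tr q x + d != 0]
      = [set x | (gamma == 0) && (Tr q x == - d)].
    apply/setP => x; rewrite !inE negbK root_trace -addr_eq0 [RHS]andbC.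
    by case: (Tr q x + d =P 0) => [->|]; rewrite ?mulr0 ?add0r.
  case: ifP => [/= _|_ /=]; first by apply: card_Tr_fiber; rewrite memK conjqN Kd.
  by apply: eq_card0 => x; rewrite !inE.
rewrite card_zeros_trace.
set Q := fun t => t ^+ 2 + (Tr q a + d) * t + (d * Tr q a + Tr q gamma).
have cardQ : (#|[set t in K | Q t == 0]|)%:Z
    = 1 + quad_char K ((Tr q a + d) ^+ 2 - 4%:R * (d * Tr q a + Tr q gamma)).
  by apply: card_quadratic; apply/KP; rewrite conjqD ?conjqM ?Kd !KTr.
have -> : [set t in K | (t + d != 0) &&
              (t + Tr q a + Tr q (gamma / (t + d)) == 0)]
    = [set t in K | Q t == 0] :\ (- d).
  apply/setP => t; rewrite !inE andbCA -addr_eq0.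
  case: eqVneq => //= td; apply: andb_id2l => /KP Kt.
  have -> : Q t = (t + d) * (t + Tr q a + Tr q (gamma / (t + d))).
    rewrite /Q (TrE gamma) (TrE (_ / _)) conjqM conjqV conjqD Kt Kd.
    by move: (conjq gamma) (Tr q a) => g' A; field.
  by rewrite mulf_eq0 (negPf td).
have QNd : Q (- d) = Tr q gamma by rewrite /Q; ring.
have := cardsD1 (- d) [set t in K | Q t == 0].
rewrite inE memK conjqN Kd eqxx QNd /= => cardD.
move: cardQ; rewrite cardD PoszD.
case: eqVneq => [_|Trg] /= => [/addrI ->|].
  by case: ifP.
rewrite add0r => ->; rewrite (_ : (gamma == 0) = false).
  by rewrite addr0 addrC.
apply: contraNF Trg => /eqP ->.
by rewrite TrE -[0]/(0%:R) conjq_nat addr0.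
Qed.

End QuadraticExtension.

Theorem proposition2 (p k q : nat) (p_prime : prime p) (k_gt0 : (0 < k)%N)
    (q_def : q = (p ^ k)%N) (q_odd : odd q)
    (F : finFieldType) (cardF : #|F| = (q ^ 2)%N)
    (K : {set F}) (subK : is_subfield_of_order K q)
    (a b c : F) :
  let f : {poly F} :=
    'X^(q.+1) + 'X^2 + a *: 'X^q + b *: 'X + c%:P in
  let gamma : F := a ^+ 2 - a * b + c in
  let epsilon : F := a ^+ q - a - b ^+ q + b in
  (a ^+ q + b \notin K ->
     num_zeros [set: F] f =
     num_zeros K
       ('X^3 - Tr q (3%:R * a - b) *: 'X^2
        + (4%:R * Tr q gamma - epsilon ^+ 2) *: 'X
        + (4%:R * Tr q (gamma * epsilon)
           + Tr q (3%:R * a - b) * epsilon ^+ 2)%:P))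
  /\
  (a ^+ q + b \in K ->
     (num_zeros [set: F] f)%:Z =
     quad_char K ((a ^+ q + b) ^+ 2 - 4%:R * Tr q c)
     + (if Tr q gamma != 0 then 1
        else if gamma == 0 then q%:Z
        else 0)).
Proof.
move=> f gamma epsilon.
have -> : num_zeros [set: F] f = #|[set x | root f x]|.
  by apply: eq_card => x; rewrite !inE.
split=> Kab.
  rewrite (card_zeros_cubic p_prime q_def q_odd cardF subK c Kab).
  by apply: eq_card => x; rewrite !inE /root !hornerE.
exact: (card_zeros_quadratic p_prime q_def q_odd cardF subK c Kab).
Qed.
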